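(* Let $F:D(F)\subseteq\mathcal X\to\mathcal Y$, $f^\dagger$, $g=F(f^\dagger)$, the Hilbert scale $\{\mathcal X_\nu\}_{\nu\in\mathbb R}$ and the indices $a,s,u$ satisfy the Basic Assumption, and let the Conditional Stability Assumption hold with concave index function $\varphi$, constant $R>0$ and admissible set $Q$ (both assumptions are spelled out in the context). For $\delta>0$ let $g^\delta\in\mathcal Y$ satisfy $\|g^\delta-g\|_{\mathcal Y}\le\delta$, and for $\alpha>0$ let $$f_\alpha^\delta\in\operatorname*{argmin}_{f\in D(F)}\left[\tfrac12\|F(f)-g^\delta\|_{\mathcal Y}^2+\alpha\|f\|_s^2\right].$$ Put $\psi_{u,s,a}(t):=\left(\varphi(\sqrt t)\right)^{\frac{2(u-s)}{a+u}}$, $t\ge0$, and suppose that $\psi_{u,s,a}$ is concave. Let $\alpha=\alpha_*=\alpha_*(\delta)>0$ be chosen such that $$-\frac1{\alpha_*}\in\partial(-\psi_{u,s,a})(\delta^2),$$ and assume that for all sufficiently small $\delta>0$ the regularized solutions $f_{\alpha_*}^\delta$ belong to $Q$. Then $$\|f_{\alpha_*}^\delta-f^\dagger\|_s=\mathcal O\left(\sqrt{\psi_{u,s,a}(\delta^2)}\right)=\mathcal O\left(\left(\varphi(\delta)\right)^{\frac{u-s}{a+u}}\right)\qquad\text{as }\delta\to0.$$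
   Context: $\mathcal X$ (norm $\|\cdot\|$) and $\mathcal Y$ (norm $\|\cdot\|_{\mathcal Y}$) are infinite-dimensional separable real Hilbert spaces, $F:D(F)\subseteq\mathcal X\to\mathcal Y$ is a possibly nonlinear operator, and $f^\dagger\in D(F)$ is the unique solution of $F(f)=g$ for the exact right-hand side $g=F(f^\dagger)$ (also written $g^\dagger$). The equation is assumed locally ill-posed at $f^\dagger$: for every $r>0$ there is a sequence $(f_n)\subset D(F)$ with $\|f_n-f^\dagger\|\le r$, $\liminf_n\|f_n-f^\dagger\|>0$ and $\|F(f_n)-F(f^\dagger)\|_{\mathcal Y}\to0$. Hilbert scale: $L:D(L)\subset\mathcal X\to\mathcal X$ is a densely defined, closed, unbounded, self-adjoint linear operator that is strictly positive, with $\|Lx\|\ge m\|x\|$ for all $x\in D(L)$ and some $m>0$. It generates the Hilbert scale $\mathcal X_\nu=D(L^\nu)$, $\nu\in\mathbb R$, $\mathcal X_0=\mathcal X$, with norms $\|x\|_\nu=\|L^\nu x\|$ (for $\nu<0$, completion of $\mathcal X$ in this norm). In the Tikhonov functional $\|f\|_s=\infty$ if $f\notin\mathcal X_s$. Balls: $D_\mu^\nu(\bar f)=\{f\in\mathcal X_\nu:\|f-\bar f\|_\nu\le\mu\}\cap D(F)$. Index function: a continuous, strictly increasing function $\varphi:[0,\infty)\to[0,\infty)$ with $\varphi(0)=0$. Basic Assumption: (a) $D(F)$ is a convex and closed subset of $\mathcal X$. (b) $F$ is weak-to-weak sequentially continuous: $x_n\rightharpoonup\bar x$ in $\mathcal X$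 with $x_n\in D(F)$ and $\bar x\in D(F)$ implies $F(x_n)\rightharpoonup F(\bar x)$ in $\mathcal Y$. (c) There is $u>0$ with $f^\dagger\in\mathcal X_u$, where $f^\dagger\in D(F)$ is the unique solution of $F(f)=g$. (d) There are indices $a,s\in\mathbb R$ with $a\ge0$, $0\le s<u\le2s+a$ and $-a<s$. Conditional Stability Assumption: there are a concave index function $\varphi$, values $\theta\ge0$, $\rho>0$, $R>0$ and a subset $Q\subseteq D_\rho^\theta(f^\dagger)$ such that $\|f-f^\dagger\|_{-a}\le R\,\varphi(\|F(f)-F(f^\dagger)\|_{\mathcal Y})$ for all $f\in Q$. Subdifferential: for convex $h:\mathbb R\to\mathbb R\cup\{+\infty\}$, $\partial h(x)=\{y\in\mathbb R: h(z)\ge h(x)+y(z-x)\ \text{for all }z\in\mathbb R\}$; the function $-\psi_{u,s,a}$, defined on $[0,\infty)$, is extended by $+\infty$ to negative arguments. *)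

(* Defs.v *)
From HB Require Import structures.
From mathcomp Require Import all_boot all_order all_algebra.
From mathcomp Require Import all_classical all_reals all_analysis.

Set Implicit Arguments.
Unset Strict Implicit.
Unset Printing Implicit Defensive.

Import Order.TTheory GRing.Theory Num.Theory.
Import numFieldNormedType.Exports.

Local Open Scope classical_set_scope.
Local Open Scope ring_scope.

(** * Real Hilbert spaces *)

HB.mixin Record CompleteNormedModule_isHilbert (R : realType) H
    of CompleteNormedModule R H := {
  inner : H -> H -> R ;
  innerC : forall x y, inner x y = inner y x ;
  innerPl : forall c x y z, inner (c *: x + y) z = c * inner x z + inner y z ;
  inner_norm : forall x, inner x x = `|x| ^+ 2
}.

#[short(type="hilbertType")]
HB.structure Definition Hilbert (R : realType) :=
  {H of CompleteNormedModule R H & CompleteNormedModule_isHilbert R H}.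

Section hilbert.
Context {R : realType}.
Implicit Types H : hilbertType R.

Definition infinite_dimensional H : Prop :=
  forall (n : nat) (v : 'I_n -> H),
    exists x : H, forall c : 'I_n -> R, x <> \sum_(i < n) c i *: v i.

Definition separable H : Prop := exists2 S : set H, countable S & dense S.

Definition weakly_cvg H (x : nat -> H) (l : H) : Prop :=
  forall y : H, (fun n => inner (x n) y) @ \oo --> inner l y.

End hilbert.

(** * Unbounded operators

   A partially defined operator is a domain [D] together with a total function
   [L] whose values outside [D] are irrelevant. *)

Section operators.
Context {R : realType} {H : hilbertType R}.
Implicit Types (D : set H) (L : H -> H).

Definition linear_on D L : Prop :=
  forall (c : R) x y, D x -> D y ->
    D (c *: x + y) /\ L (c *: x + y) = c *: L x + L y.

Definition closed_operator D L : Prop :=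
  closed [set p : H * H | D p.1 /\ L p.1 = p.2].

Definition unbounded_operator D L : Prop :=
  ~ exists C : R, forall x, D x -> `|L x| <= C * `|x|.

(* [(y, z)] is in the graph of the adjoint iff it is in the graph of [L]. *)
Definition selfadjoint D L : Prop :=
  forall y z, (forall x, D x -> inner (L x) y = inner x z) <-> D y /\ L y = z.

Definition scale_generator D L : Prop :=
  [/\ [/\ linear_on D L, dense D & closed_operator D L],
      unbounded_operator D L,
      selfadjoint D L,
      forall x, D x -> x <> 0 -> 0 < inner (L x) x
    & exists2 m : R, 0 < m & forall x, D x -> m * `|x| <= `|L x|].

End operators.

(** * Projection-valued measures and functional calculus *)

Record pvm (R : realType) (H : hilbertType R) := Pvm {
  pvm_fun :> set (measurableTypeR R) -> H -> H ;
  pvm_linear : forall A c x y, measurable A ->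
    pvm_fun A (c *: x + y) = c *: pvm_fun A x + pvm_fun A y ;
  pvm_sym : forall A x y, measurable A ->
    inner (pvm_fun A x) y = inner x (pvm_fun A y) ;
  pvmI : forall A B x, measurable A -> measurable B ->
    pvm_fun (A `&` B) x = pvm_fun A (pvm_fun B x) ;
  pvmT : forall x, pvm_fun setT x = x ;
  pvm_sigma_additive : forall (A : nat -> set (measurableTypeR R)) x,
    (forall n, measurable (A n)) -> trivIset setT A ->
    series (fun n => pvm_fun (A n) x) @ \oo --> pvm_fun (\bigcup_n A n) x
}.

Section spectral_calculus.
Context {R : realType} {H : hilbertType R}.
Variable E : pvm H.

(* As [E A] is an orthogonal projection, [`|E A x|^2 = <E A x, x>]. *)
Definition pvm_measure (x : H) (A : set (measurableTypeR R)) : \bar R :=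
  (`|E A x| ^+ 2)%:E.

Let innerDl (x y z : H) : inner (x + y) z = inner x z + inner y z.
Proof. by rewrite -[x in LHS]scale1r innerPl mul1r. Qed.

Let inner0l (z : H) : inner 0 z = 0.
Proof. by apply: (addrI (inner 0 z)); rewrite -innerDl !addr0. Qed.

Let pvm0 x : E set0 x = 0.
Proof.
have /cvgP/cvg_series_cvg_0 h : series (fun=> E set0 x) @ \oo --> E set0 x.
  rewrite -[X in _ --> E X x](@bigcup0 _ nat setT (fun=> set0))//.
  by apply: (@pvm_sigma_additive _ _ E (fun=> set0)) => //; exact: trivIset_set0.
by apply: cvg_unique h; [exact: norm_hausdorff|exact: cvg_cst].
Qed.

Let pvm_measure0 x : pvm_measure x set0 = 0%E.
Proof. by rewrite /pvm_measure pvm0 normr0 expr0n. Qed.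

Let pvm_measure_ge0 x A : (0 <= pvm_measure x A)%E.
Proof. by rewrite /pvm_measure lee_fin exprn_ge0. Qed.

Let pvm_measure_sigma_additive x : semi_sigma_additive (pvm_measure x).
Proof.
move=> A mA tA _; rewrite /pvm_measure.
have orth i j : (i != j)%N -> inner (E (A i) x) (E (A j) x) = 0.
  move=> ij; rewrite pvm_sym// -pvmI//.
  by move/trivIsetP : tA => /(_ i j Logic.I Logic.I ij) ->; rewrite pvm0 innerC inner0l.
have pyth n : \sum_(0 <= i < n) `|E (A i) x| ^+ 2 =
    `|series (fun i => E (A i) x) n| ^+ 2.
  elim: n => [|n ih]; first by rewrite /series /= !big_geq// normr0 expr0n.
  rewrite big_nat_recr//= ih /series/= big_nat_recr//= -!inner_norm.
  set s := \sum_(0 <= i < n) _; set e := E (A n) x.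
  have se : inner s e = 0.
    rewrite /s big_nat; elim/big_ind : _ => [|u v hu hv|i /andP[_ ilt]].
    - exact: inner0l.
    - by rewrite innerDl hu hv addr0.
    - by apply: orth; rewrite ltn_eqF.
  rewrite innerDl (innerC s) (innerC e (s + e)) !innerDl (innerC e s) se.
  by rewrite addr0 add0r.
under eq_fun do rewrite sumEFin pyth.
apply/fine_cvgP; split; first exact: nearW.
rewrite (_ : _ \o _ = fun n => `|series (fun i => E (A i) x) n| *
  `|series (fun i => E (A i) x) n|); last by apply/funext.
by rewrite expr2; apply: cvgM; apply: cvg_norm; exact: pvm_sigma_additive.
Qed.

HB.instance Definition _ (x : H) := isMeasure.Build _ _ _ (pvm_measure x)
  (pvm_measure0 x) (pvm_measure_ge0 x) (@pvm_measure_sigma_additive x).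

Import HBSimple.

Definition pvm_sintegral (g : {sfun measurableTypeR R >-> R}) (x : H) : H :=
  \sum_(c \in range g) c *: E (g @^-1` [set c]) x.

(* [z] is the vector [\int h dE x], obtained by extending the isometry
   [g |-> \int g dE x] from simple functions to [L^2(pvm_measure x)]. *)
Definition is_pvm_integral (h : R -> R) (x z : H) : Prop :=
  exists g : nat -> {sfun measurableTypeR R >-> R},
    (fun n => \int[pvm_measure x]_l (((h l - g n l) ^+ 2)%:E))%E @ \oo --> 0%E
    /\ (fun n => pvm_sintegral (g n) x) @ \oo --> z.

Definition pvm_domain (h : R -> R) : set H :=
  [set x | (pvm_measure x).-integrable setT (fun l => (h l ^+ 2)%:E)].

Definition pvm_integral (h : R -> R) (x : H) : H :=
  xget 0 [set z | is_pvm_integral h x z].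

(* [L = \int l dE_l]; by the spectral theorem every self-adjoint operator has,
   up to its values on non-Borel sets, exactly one such [E]. *)
Definition spectral_measure_of (D : set H) (L : H -> H) : Prop :=
  D = pvm_domain id /\ forall x, D x -> is_pvm_integral id x (L x).

(** * Hilbert scale generated by the operator with spectral measure [E] *)

Definition op_power (nu : R) : H -> H := pvm_integral (fun l => l `^ nu).

(* For [nu < 0] (and [L] bounded below) this is all of [H]: the elements of the
   completion that lie outside [H] are not represented. *)
Definition scale_space (nu : R) : set H := pvm_domain (fun l => l `^ nu).

Definition scale_norm (nu : R) (x : H) : R := `|op_power nu x|.

Definition escale_norm (nu : R) (x : H) : \bar R :=
  if x \in scale_space nu then (scale_norm nu x)%:E else +oo%E.

Definition scale_ball (DF : set H) (nu mu : R) (x0 : H) : set H :=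
  [set x | scale_space nu x /\ (escale_norm nu (x - x0)%R <= mu%:E)%E] `&` DF.

End spectral_calculus.

(** * Index functions, subdifferentials *)

Section convex_analysis.
Context {R : realType}.

Definition index_function (phi : R -> R) : Prop :=
  [/\ forall t, 0 <= t -> 0 <= phi t,
      {within `[0, +oo[, continuous phi},
      {in `[0, +oo[ &, {homo phi : x y / x < y}}
    & phi 0 = 0].

Definition concave_on_nonneg (phi : R -> R) : Prop :=
  convex_function (`[0, +oo[%classic : set R) (fun t => - phi t).

Definition subdifferential (h : R -> \bar R) (x : R) : set R :=
  [set y | forall z, (h x + (y * (z - x))%:E <= h z)%E].

Definition extend_pinfty (h : R -> R) (t : R) : \bar R :=
  if 0 <= t then (h t)%:E else +oo%E.

Definition psi (phi : R -> R) (u s a : R) (t : R) : R :=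
  phi (Num.sqrt t) `^ (2 * (u - s) / (a + u)).

End convex_analysis.

(** * The inverse problem *)

Section inverse_problem.
Context {R : realType} {X Y : hilbertType R}.
Variables (E : pvm X) (DF : set X) (F : X -> Y).

Definition locally_ill_posed (fdag : X) : Prop :=
  forall r : R, 0 < r -> exists f : nat -> X,
    [/\ forall n, DF (f n) /\ `|f n - fdag| <= r,
        (0 < limn_einf (fun n => `|f n - fdag|%:E))%E
      & (fun n => `|F (f n) - F fdag|) @ \oo --> (0 : R)].

Definition unique_solution (g : Y) (fdag : X) : Prop :=
  [/\ DF fdag, F fdag = g & forall f, DF f -> F f = g -> f = fdag].

Definition weak_to_weak_continuous : Prop :=
  forall (x : nat -> X) (xbar : X), (forall n, DF (x n)) -> DF xbar ->
    weakly_cvg x xbar -> weakly_cvg (F \o x) (F xbar).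

Definition basic_assumption (g : Y) (fdag : X) (a s u : R) : Prop :=
  [/\ convex_set DF /\ closed DF,
      weak_to_weak_continuous,
      [/\ 0 < u, scale_space E u fdag & unique_solution g fdag]
    & [/\ 0 <= a, 0 <= s, s < u, u <= 2 * s + a & - a < s]].

Definition conditional_stability (fdag : X) (a : R) (phi : R -> R)
    (theta rho C : R) (Q : set X) : Prop :=
  [/\ index_function phi /\ concave_on_nonneg phi,
      [/\ 0 <= theta, 0 < rho & 0 < C],
      Q `<=` scale_ball E DF theta rho fdag
    & forall f, Q f ->
        (escale_norm E (- a)%R (f - fdag)%R <= (C * phi `|F f - F fdag|)%:E)%E].

Definition tikhonov (s alpha : R) (gd : Y) (f : X) : \bar R :=
  ((2^-1 * `|F f - gd| ^+ 2)%:E + alpha%:E * escale_norm E s f ^+ 2)%E.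

Definition tikhonov_minimizer (s alpha : R) (gd : Y) (f : X) : Prop :=
  DF f /\ forall f', DF f' -> (tikhonov s alpha gd f <= tikhonov s alpha gd f')%E.

End inverse_problem.

(* Main.v *)
Require Import Defs.
From mathcomp Require Import all_boot all_order all_algebra finmap.
From mathcomp Require Import all_classical all_reals all_analysis.
From mathcomp Require Import measurable_realfun.
From mathcomp Require Import ring lra.
Import Order.TTheory GRing.Theory Num.Theory.
Import numFieldNormedType.Exports.
Local Open Scope classical_set_scope.
Local Open Scope ring_scope.
Set Implicit Arguments.
Unset Strict Implicit.
Unset Printing Implicit Defensive.

(** Write [y = f - fdag] for the error, [kappa = (u - s) / (a + u)] and
    [b = C * phi `|F f - F fdag|], so that the stability assumption reads
    [|y|_(-a) <= b].

    The stability assumption turns into a variational source condition,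
    [|fdag|_s^2 + |y|_s^2 / 2 <= |f|_s^2 + M * psi (`|F f - F fdag|^2)].
    Formally, [|f|_s^2 = |fdag|_s^2 + 2 <fdag, y>_s + |y|_s^2], and the cross
    term is a pairing of the components of [fdag] and [y] at each spectral
    value [l] with weight [l^(2s)].  Young's inequality with a constant that
    depends on [l] ([spectral_Young]) bounds it by a part of [|y|_s^2] plus
    [Lambda^(-2(u-s)) |fdag|_u^2 + Lambda^(2(s+a)) |y|_(-a)^2], up to constants,
    for every cut-off [Lambda > 0] ([scale_Young]); this is where
    [u <= 2s + a] enters.  With [Lambda = b^(-1/(a+u))] both terms are
    multiples of [b^(2 kappa)] ([scale_source]), that is, of
    [psi (`|F f - F fdag|^2)].

    Comparing the Tikhonov functional at the minimiser with its value at [fdag]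
    then leaves [M * psi T - T / (4 alpha)], with [T = `|F f - F fdag|^2], to be
    bounded by a multiple of [psi (d^2)].  The subgradient condition says that
    the line of slope [1 / alpha] through [(d^2, psi (d^2))] lies above [psi],
    which would be enough only for small [M].  But [phi] is concave, so
    [psi (mu^2 t) <= mu^(2 kappa) psi t] for [mu >= 1], and as [kappa < 1] a
    large dilation makes the slope as small as one wants at the price of a
    constant ([tangent_le_absorb]).  The tangent at [0] gives
    [d^2 / alpha <= psi (d^2)], which controls the noise.

    On the operator side the proof rests on two facts about the spectral measure:
    [|pvm_integral h x|^2] is the integral of [h^2] against the measure
    [A |-> |E A x|^2] ([norm_pvm_integral]), which turns every scale norm into
    an integral of a power of [l]; and [E {0} = 0] ([pvm_singleton0]), because
    the generator is bounded from below, so that the laws of exponents hold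
    almost everywhere. *)

(** * Inner products *)

Section inner_product.
Context {R : realType} {H : hilbertType R}.
Implicit Types (x y z : H) (c : R).

Lemma innerDl x y z : inner (x + y) z = inner x z + inner y z.
Proof. by rewrite -[x in LHS]scale1r innerPl mul1r. Qed.

Lemma inner0l z : inner 0 z = 0.
Proof. by apply: (addrI (inner 0 z)); rewrite -innerDl !addr0. Qed.

Lemma innerZl c x z : inner (c *: x) z = c * inner x z.
Proof. by rewrite -[c *: x]addr0 innerPl inner0l addr0. Qed.

Lemma innerDr x y z : inner z (x + y) = inner z x + inner z y.
Proof. by rewrite ![inner z _]innerC innerDl. Qed.

Lemma innerZr c x z : inner z (c *: x) = c * inner z x.
Proof. by rewrite ![inner z _]innerC innerZl. Qed.

Lemma inner_suml (I : Type) (r : seq I) (v : I -> H) z :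
  inner (\sum_(i <- r) v i) z = \sum_(i <- r) inner (v i) z.
Proof.
elim: r => [|i r IHr]; first by rewrite !big_nil inner0l.
by rewrite !big_cons innerDl IHr.
Qed.

Lemma normD_sqr c x y :
  `|x + c *: y| ^+ 2 = `|x| ^+ 2 + 2 * c * inner x y + c ^+ 2 * `|y| ^+ 2.
Proof.
rewrite -!inner_norm innerDl !innerDr !innerZl !innerZr (innerC y x).
by ring.
Qed.

Lemma normB_sqr x y : `|x - y| ^+ 2 = `|x| ^+ 2 + `|y| ^+ 2 - 2 * inner x y.
Proof. by rewrite -scaleN1r normD_sqr; ring. Qed.

Lemma normB_sqr_le x y : `|x - y| ^+ 2 <= 2 * `|x| ^+ 2 + 2 * `|y| ^+ 2.
Proof.
have := normB_sqr x y; have := normD_sqr 1 x y; rewrite scale1r => xDy ->.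
have := sqr_ge0 `|x + y|; rewrite xDy; lra.
Qed.

(** Young's inequality for the cross term [2 <x, y>], in the form that survives
    replacing squared norms by measures. *)
Lemma normD_sqr_Young c x y : 0 < c ->
  `|x| ^+ 2 + `|y| ^+ 2 <= `|x + y| ^+ 2 + (c * `|x| ^+ 2 + c^-1 * `|y| ^+ 2).
Proof.
move=> c0; have := normD_sqr 1 x y; rewrite scale1r => ->.
have := normD_sqr c^-1 x y => xDy.
have : 0 <= c * `|x + c^-1 *: y| ^+ 2 by rewrite mulr_ge0 ?sqr_ge0 ?ltW.
have -> : c * `|x + c^-1 *: y| ^+ 2 =
    c * `|x| ^+ 2 + 2 * inner x y + c^-1 * `|y| ^+ 2.
  by rewrite xDy; field; rewrite gt_eqF.
lra.
Qed.

End inner_product.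

(** * Simple functions of a projection-valued measure *)

Section spectral_measure.
Context {R : realType} {H : hilbertType R}.
Variable E : pvm H.
Implicit Types (x y : H) (A B : set (measurableTypeR R)).

Import HBSimple.

Lemma pvm_measureE x A : pvm_measure E x A = (`|E A x| ^+ 2)%:E.
Proof. by []. Qed.

Lemma inner_pvm A B x : measurable A -> measurable B ->
  inner (E A x) (E B x) = `|E (A `&` B) x| ^+ 2.
Proof.
move=> mA mB; have mAB := measurableI _ _ mA mB.
by rewrite -inner_norm !pvm_sym// -!pvmI// setIid.
Qed.

Lemma pvm_measureT_fin x : (pvm_measure E x setT < +oo)%E.
Proof. by rewrite pvm_measureE ltry. Qed.

Lemma sfun_integrable x (g : {sfun measurableTypeR R >-> R}) :
  (pvm_measure E x).-integrable setT (EFin \o g).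
Proof.
apply: measurable_bounded_integrable => //.
  exact: pvm_measureT_fin.
have [M [Mr hM]] := simple_bounded g.
exists M; split => // K MK t _; exact: hM.
Qed.

(** Expands one simple factor over its values; applied once to each factor it
    computes the integral of a product of two simple functions. *)
Lemma Rintegral_sfunM x (p g : {sfun measurableTypeR R >-> R}) :
  \int[pvm_measure E x]_t (p t * g t) =
  \sum_(c <- fset_set (range g))
     c * \int[pvm_measure E x]_t (p t * \1_(g @^-1` [set c]) t).
Proof.
rewrite (@eq_Rintegral _ _ _ _ setT (fun t => \sum_(c <- fset_set (range g))
    (c * (p t * \1_(g @^-1` [set c]) t)))); last first.
  move=> t _; rewrite [g t]fimfunE fsbig_finite//= mulr_sumr.
  by apply: eq_bigr => c _; rewrite mulrCA.
have ip c : (pvm_measure E x).-integrable setT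
    (EFin \o (fun t => p t * \1_(g @^-1` [set c]) t)).
  have mA : measurable (g @^-1` [set c]) by exact: measurable_sfunP.
  exact: (sfun_integrable x (p * indic_sfun _ mA)).
elim: (fset_set _ : seq R) => [|c r IHr].
  under eq_Rintegral do rewrite big_nil.
  by rewrite big_nil Rintegral_cst// mul0r.
under eq_Rintegral do rewrite big_cons.
rewrite big_cons RintegralD//.
- by rewrite IHr RintegralZl.
- apply/(eq_integrable measurableT (fun t => c%:E * (p t * \1_(g @^-1` [set c]) t)%:E)%E) => //.
  exact: (integrableZl measurableT c (ip c)).
- apply/(eq_integrable measurableT (fun t => \sum_(c <- r) (c%:E * (p t * \1_(g @^-1` [set c]) t)%:E))%E).
  + by move=> t _; rewrite /= -sumEFin.
  + apply: integrable_sum => // d _.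
    exact: (integrableZl measurableT d (ip d)).
Qed.

(** The polarised form of the isometry.  It yields distances between integrals
    of different simple functions without a common refinement of their
    partitions. *)
Lemma inner_sintegral x (g h : {sfun measurableTypeR R >-> R}) :
  inner (pvm_sintegral E g x) (pvm_sintegral E h x) =
  \int[pvm_measure E x]_t (g t * h t).
Proof.
have mg c : measurable (g @^-1` [set c]) by exact: measurable_sfunP.
have mh c : measurable (h @^-1` [set c]) by exact: measurable_sfunP.
rewrite /pvm_sintegral !fsbig_finite//= Rintegral_sfunM innerC inner_suml.
apply: eq_bigr => d _; rewrite innerZl innerC; congr (_ * _).
rewrite inner_suml; under eq_Rintegral do rewrite mulrC.
rewrite (Rintegral_sfunM x (indic_sfun _ (mh d)) g).
apply: eq_bigr => c _; rewrite innerZl inner_pvm//; congr (_ * _).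
rewrite /Rintegral /=.
have -> : (fun t => (\1_(h @^-1` [set d]) t * \1_(g @^-1` [set c]) t)%:E) =
    (fun t => (\1_((g @^-1` [set c]) `&` (h @^-1` [set d])) t : R)%:E).
  by apply/funext => t; rewrite indicI/= mulrC.
by rewrite integral_indic ?setIT//; exact: measurableI.
Qed.

End spectral_measure.

(** * The isometry for spectral integrals *)

Lemma le_Dmul_gt0 (R : realFieldType) (a b : R) : 0 <= b ->
  (forall e, 0 < e -> a <= (1 + e) * b) -> a <= b.
Proof.
move=> b0 ab; apply/ler_addgt0Pr => e e0.
have b1 : 0 < b + 1 by lra.
have := ab _ (divr_gt0 e0 b1) => /le_trans; apply.
rewrite mulrDl mul1r lerD2l -mulrA ler_piMr ?(ltW e0)//.
by rewrite mulrC ler_pdivrMr// mul1r; lra.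
Qed.

Section pvm_integral_norm.
Context {R : realType} {H : hilbertType R}.
Variable E : pvm H.
Implicit Types (x z : H) (h : R -> R).

Import HBSimple HBNNSimple.

Lemma norm_sintegralB x (g k : {sfun measurableTypeR R >-> R}) :
  `|pvm_sintegral E g x - pvm_sintegral E k x| ^+ 2 =
  \int[pvm_measure E x]_t ((g t - k t) ^+ 2).
Proof.
have gk : (pvm_measure E x).-integrable setT
  (EFin \o (fun t => g t * g t + k t * k t)) := sfun_integrable E x (g * g + k * k).
have kg : (pvm_measure E x).-integrable setT
  (EFin \o (fun t => 2 * (g t * k t))) :=
  sfun_integrable E x (cst_sfun 2 * (g * k)).
have gg : (pvm_measure E x).-integrable setT
  (EFin \o (fun t => g t * g t)) := sfun_integrable E x (g * g).
have kk : (pvm_measure E x).-integrable setT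
  (EFin \o (fun t => k t * k t)) := sfun_integrable E x (k * k).
have gk' : (pvm_measure E x).-integrable setT
  (EFin \o (fun t => g t * k t)) := sfun_integrable E x (g * k).
rewrite normB_sqr -!inner_norm !inner_sintegral -RintegralZl// -RintegralD//.
by rewrite -RintegralB//; apply: eq_Rintegral => t _; ring.
Qed.

Lemma norm_sintegral x (g : {sfun measurableTypeR R >-> R}) :
  `|pvm_sintegral E g x| ^+ 2 = \int[pvm_measure E x]_t (g t ^+ 2).
Proof.
by rewrite -inner_norm inner_sintegral; apply: eq_Rintegral => t _; ring.
Qed.

Lemma integrable_sqrB x h (g : {sfun measurableTypeR R >-> R}) :
  measurable_fun setT h -> pvm_domain E h x ->
  (pvm_measure E x).-integrable setT (EFin \o (fun t => (h t - g t) ^+ 2)).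
Proof.
move=> mh hx.
have gg : (pvm_measure E x).-integrable setT
  (EFin \o (fun t => g t * g t)) := sfun_integrable E x (g * g).
have dom : (pvm_measure E x).-integrable setT
    (EFin \o (fun t => 2 * (h t ^+ 2 + g t * g t))) :=
  integrableZl measurableT 2 (integrableD measurableT hx gg).
apply: (le_integrable measurableT _ _ dom).
  apply/measurable_EFinP; apply: measurable_funX; apply: measurable_funB => //.
move=> t _ /=; rewrite lee_fin !ger0_norm ?sqr_ge0//.
  have := sqr_ge0 (h t + g t); rewrite !expr2; lra.
by rewrite mulr_ge0// addr_ge0 ?sqr_ge0// -expr2 sqr_ge0.
Qed.

Lemma fine_sqrB_cvg0 x h (g : nat -> {sfun measurableTypeR R >-> R}) :
  (fun n => \int[pvm_measure E x]_l (((h l - g n l) ^+ 2)%:E))%E @ \oo --> 0%E ->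
  (fun n => \int[pvm_measure E x]_l ((h l - g n l) ^+ 2)) @ \oo --> 0.
Proof. by move/fine_cvg. Qed.

(** Both integrands are square integrable and at distance tending to [0] in L^2,
    so the L^2 norms converge; the factor [1 + e] comes from Young's inequality
    and is removed by [le_Dmul_gt0]. *)
Lemma is_pvm_integral_norm h x z :
  measurable_fun setT h -> pvm_domain E h x -> is_pvm_integral E h x z ->
  `|z| ^+ 2 = \int[pvm_measure E x]_t (h t ^+ 2).
Proof.
move=> mh hx [g [/fine_sqrB_cvg0 dg gz]].
have ig n : (pvm_measure E x).-integrable setT
  (EFin \o (fun t => g n t * g n t)) := sfun_integrable E x (g n * g n).
have ig2 n : (pvm_measure E x).-integrable setT (EFin \o (fun t => g n t ^+ 2)).
  by apply: eq_integrable (ig n) => // t _; rewrite /= expr2.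
have id n := integrable_sqrB (g n) mh hx.
pose mu := pvm_measure E x.
have gz2 : (fun n => \int[mu]_t (g n t ^+ 2)) @ \oo --> `|z| ^+ 2.
  rewrite (_ : (fun n => _) =
      fun n => `|pvm_sintegral E (g n) x| * `|pvm_sintegral E (g n) x|); last first.
    by apply/funext => n; rewrite -expr2 norm_sintegral.
  by rewrite expr2; apply: cvgM; apply: cvg_norm.
have key (p q r : R -> R) e : 0 < e ->
    mu.-integrable setT (EFin \o p) -> mu.-integrable setT (EFin \o q) ->
    mu.-integrable setT (EFin \o r) ->
    (forall t, p t <= (1 + e) * q t + (1 + e^-1) * r t) ->
    \int[mu]_t p t <= (1 + e) * \int[mu]_t q t + (1 + e^-1) * \int[mu]_t r t.
  move=> e0 ip iq ir pqr; rewrite -!RintegralZl//.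
  have iq' := integrableZl measurableT (1 + e) iq.
  have ir' := integrableZl measurableT (1 + e^-1) ir.
  rewrite -RintegralD//; apply: le_Rintegral => //.
  exact: (integrableD measurableT iq' ir').
have young (e a b : R) : 0 < e ->
    a ^+ 2 <= (1 + e) * b ^+ 2 + (1 + e^-1) * (b - a) ^+ 2.
  move=> e0; rewrite -subr_ge0.
  have -> : (1 + e) * b ^+ 2 + (1 + e^-1) * (b - a) ^+ 2 - a ^+ 2 =
      e^-1 * ((1 + e) * b - a) ^+ 2 by field; rewrite gt_eqF.
  by rewrite mulr_ge0 ?sqr_ge0// invr_ge0 ltW.
apply/eqP; rewrite eq_le; apply/andP; split.
- apply: le_Dmul_gt0 => [|e e0].
    by apply: Rintegral_ge0 => t _; exact: sqr_ge0.
  have lim : (fun n => (1 + e) * \int[mu]_t (h t ^+ 2) +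
      (1 + e^-1) * \int[mu]_t ((h t - g n t) ^+ 2)) @ \oo -->
      (1 + e) * \int[mu]_t (h t ^+ 2).
    rewrite -[X in _ --> X]addr0 -[X in _ --> _ + X](mulr0 (1 + e^-1)).
    by apply: cvgD; [exact: cvg_cst|apply: cvgMr].
  apply: (ler_cvg_to gz2 lim); apply: nearW => n.
  by apply: key => // t; exact: young.
- apply: le_Dmul_gt0 => [|e e0]; first exact: sqr_ge0.
  have lim : (fun n => (1 + e) * \int[mu]_t (g n t ^+ 2) +
      (1 + e^-1) * \int[mu]_t ((h t - g n t) ^+ 2)) @ \oo -->
      (1 + e) * `|z| ^+ 2.
    rewrite -[X in _ --> X]addr0 -[X in _ --> _ + X](mulr0 (1 + e^-1)).
    by apply: cvgD; apply: cvgMr.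
  apply: (ler_cvg_to (cvg_cst _) lim); apply: nearW => n.
  by apply: key => // t; rewrite -(sqrrN (h t - _)) opprB; exact: young.
Qed.

(** Dyadic approximation from below converges in L^2 by dominated convergence;
    by the isometry on simple functions the approximating vectors are Cauchy. *)
Lemma is_pvm_integral_exists h x :
  measurable_fun setT h -> (forall t, 0 <= h t) -> pvm_domain E h x ->
  exists z, is_pvm_integral E h x z.
Proof.
move=> mh h0 hx.
have mhE : measurable_fun setT (EFin \o h : measurableTypeR R -> \bar R).
  exact/measurable_EFinP.
pose g n : {sfun measurableTypeR R >-> R} := nnsfun_approx measurableT mhE n.
have gh n t : 0 <= g n t <= h t.
  apply/andP; split; first exact: (@fun_ge0 _ _ (nnsfun_approx measurableT mhE n)).
  have -> : g n t = _ := congr1 (@^~ t) (nnsfun_approxE measurableT mhE n).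
  rewrite -lee_fin; apply: (@le_approx _ _ _ setT (EFin \o h)) => //.
  by move=> s _; rewrite lee_fin.
have gcvg t : g n t @[n --> \oo] --> h t.
  apply: (@fine_cvg _ _ _ _ (fun n => (g n t)%:E) (h t)).
  apply: (@cvg_nnsfun_approx _ _ _ _ measurableT _ mhE) => // s _.
  by rewrite lee_fin.
have dg : (fun n => \int[pvm_measure E x]_l (((h l - g n l) ^+ 2)%:E))%E @ \oo --> 0%E.
  have [] := @dominated_convergence _ _ _ (pvm_measure E x) _ measurableT
    (fun n t => ((h t - g n t) ^+ 2)%:E) (cst 0%E) (fun t => (h t ^+ 2)%:E).
  - move=> n; apply/measurable_EFinP; apply: measurable_funX.
    by apply: measurable_funB.
  - exact: measurable_cst.
  - apply: aeW => t _; apply: cvg_EFin; first exact: nearW.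
    rewrite (_ : fine \o _ = fun n => (h t - g n t) * (h t - g n t)); last first.
      by apply/funext => n; rewrite /= expr2.
    rewrite /= -(mulr0 0); apply: cvgM; rewrite -(subrr (h t));
      by apply: cvgB; [exact: cvg_cst|exact: gcvg].
  - exact: hx.
  - apply: aeW => t n _; rewrite /= lee_fin ger0_norm ?sqr_ge0//.
    have /andP[g0 gle] := gh n t.
    by rewrite ler_sqr ?nnegrE// ?subr_ge0// lerBlDr lerDl.
  by move=> _ _ ; rewrite integral0.
have /fine_sqrB_cvg0 dg' := dg.
suff /cvg_ex[z gz] : cvg ((fun n => pvm_sintegral E (g n) x) @ \oo).
  by exists z, g.
apply/cauchy_cvgP/cauchy_exP => e e0.
have e4 : 0 < e ^+ 2 / 4 by rewrite divr_gt0 ?exprn_gt0.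
have /cvgr0_norm_lt/(_ _ e4)[N _ hN] := dg'.
exists (pvm_sintegral E (g N) x); exists N => //= n Nn.
rewrite -ball_normE /ball_/=.
rewrite -(@ltr_pXn2r _ 2) ?nnegrE ?(ltW e0)// norm_sintegralB.
have id k := integrable_sqrB (g k) mh hx.
have iD := integrableZl measurableT 2 (integrableD measurableT (id N) (id n)).
apply: (@le_lt_trans _ _ (2 * (\int[pvm_measure E x]_t ((h t - g N t) ^+ 2) +
    \int[pvm_measure E x]_t ((h t - g n t) ^+ 2)))).
  rewrite -RintegralD// -RintegralZl//; last first.
    exact: (integrableD measurableT (id N) (id n)).
  apply: le_Rintegral => //.
    have := sfun_integrable E x ((g N - g n) * (g N - g n)).
    by apply: eq_integrable => // t _; rewrite /= expr2.
  move=> t _; have := sqr_ge0 (h t - g N t + (h t - g n t)).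
  by rewrite !expr2; lra.
have bound k : (N <= k)%N ->
    \int[pvm_measure E x]_t ((h t - g k t) ^+ 2) < e ^+ 2 / 4.
  by move=> /hN; apply: le_lt_trans; exact: ler_norm.
have := bound _ Nn; have := bound _ (leqnn N); lra.
Qed.

Lemma norm_pvm_integral h x :
  measurable_fun setT h -> (forall t, 0 <= h t) -> pvm_domain E h x ->
  ((`|pvm_integral E h x| ^+ 2)%:E = \int[pvm_measure E x]_t (h t ^+ 2)%:E)%E.
Proof.
move=> mh h0 hx; have [z hz] := is_pvm_integral_exists mh h0 hx.
rewrite (@is_pvm_integral_norm h x)//; last first.
  by apply: (@xgetPex _ 0 [set z | is_pvm_integral E h x z]); exists z.
by rewrite /Rintegral fineK// integrable_fin_num.
Qed.

End pvm_integral_norm.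

(** * Young's inequality for spectral measures *)

Section spectral_Young.
Context {R : realType} {H : hilbertType R}.
Variable E : pvm H.
Implicit Types (x y : H) (w c h : R -> R) (A : set (measurableTypeR R)).

Lemma pvmD A x y : measurable A -> E A (x + y) = E A x + E A y.
Proof. by move=> mA; rewrite -[x in LHS]scale1r pvm_linear// scale1r. Qed.

Lemma pvmB A x y : measurable A -> E A (x - y) = E A x - E A y.
Proof.
by move=> mA; rewrite addrC -scaleN1r pvm_linear// scaleN1r addrC.
Qed.

(** For a constant [k] the inequality [normD_sqr_Young] holds on every Borel set,
    so it is an inequality between measures. *)
Lemma spectral_Young_slice A (k : R) w x y :
  measurable A -> 0 < k -> measurable_fun setT w -> (forall t, 0 <= w t) ->
  (\int[pvm_measure E x]_(t in A) (w t)%:E +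
   \int[pvm_measure E y]_(t in A) (w t)%:E <=
   \int[pvm_measure E (x + y)%R]_(t in A) (w t)%:E +
   (k%:E * \int[pvm_measure E x]_(t in A) (w t)%:E +
    k^-1%:E * \int[pvm_measure E y]_(t in A) (w t)%:E))%E.
Proof.
move=> mA k0 mw w0.
have k10 : 0 <= k^-1 by rewrite invr_ge0 ltW.
have mwE D : measurable_fun D (fun t : measurableTypeR R => (w t)%:E).
  by apply/measurable_EFinP; exact: measurable_funTS.
have w0E (t : R) : (0 <= (w t)%:E)%E by rewrite lee_fin.
pose kx := mscale (NngNum (ltW k0)) (pvm_measure E x).
pose ky := mscale (NngNum k10) (pvm_measure E y).
rewrite -(ge0_integral_mscale _ mA (NngNum (ltW k0)))//.
rewrite -(ge0_integral_mscale _ mA (NngNum k10))//.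
rewrite -!ge0_integral_measure_add//.
apply: ge0_le_measure_integral => // S mS.
rewrite [leLHS](_ : _ = pvm_measure E x S + pvm_measure E y S)%E; last first.
  exact: measure_addE.
rewrite [leRHS](_ : _ = pvm_measure E (x + y)%R S +
    (k%:E * pvm_measure E x S + k^-1%:E * pvm_measure E y S))%E; last first.
  by rewrite -[X in (_ + X)%E](measure_addE kx ky); exact: measure_addE.
rewrite !pvm_measureE -!EFinM -!EFinD lee_fin.
by rewrite pvmD//; exact: normD_sqr_Young.
Qed.

Lemma integral_slices x (F : (set (measurableTypeR R))^nat) (f : R -> \bar R) :
  (forall n, measurable (F n)) -> trivIset setT F -> \bigcup_n F n = setT ->
  measurable_fun setT f -> (forall t, 0 <= f t)%E ->
  (\int[pvm_measure E x]_t f t = \sum_(n <oo) \int[pvm_measure E x]_(t in F n) f t)%E.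
Proof. by move=> mF tF FT mf f0; rewrite -ge0_integral_bigcup ?FT. Qed.

(** The sets on which [c] is constant up to a factor [expR 1], indexed by [nat]
    through the countability of [int], as [ge0_integral_bigcup] needs a
    sequence. *)
Definition log_slice c (n : nat) : set R :=
  if @pickle_inv int n is Some k
  then [set t | k%:~R <= ln (c t) < k%:~R + 1] else set0.

Lemma measurable_log_slice c n :
  measurable_fun setT c -> measurable (log_slice c n : set (measurableTypeR R)).
Proof.
move=> mc; rewrite /log_slice; case: pickle_inv => [k|]; last exact: measurable0.
have mln : measurable_fun setT (fun t => ln (c t)).
  by apply: measurableT_comp => //; exact: measurable_ln.
have -> : [set t | k%:~R <= ln (c t) < k%:~R + 1] =
    setT `&` (fun t => ln (c t)) @^-1` [set` `[k%:~R, k%:~R + 1[%R].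
  by rewrite setTI; apply/seteqP; split => t /=; rewrite in_itv.
exact: mln.
Qed.

Lemma trivIset_log_slice c : trivIset setT (log_slice c).
Proof.
move=> i j _ _ [t []]; rewrite /log_slice.
case ki : (pickle_inv i) => [k|//]; case lj : (pickle_inv j) => [l|//] /=.
move=> /andP[kt tk] /andP[lt tl].
have kl : k = l.
  apply/eqP; rewrite eq_le -!ltzD1 -!(@ltr_int R) !intrD.
  by rewrite (le_lt_trans kt)// (le_lt_trans lt).
have := @pickle_invK int i; have := @pickle_invK int j.
by rewrite ki lj kl /= => <- <-.
Qed.

Lemma bigcup_log_slice c : \bigcup_n log_slice c n = setT.
Proof.
apply/seteqP; split=> t _; first exact: Logic.I.
exists (choice.pickle (Num.floor (ln (c t)))); first exact: Logic.I.
rewrite /log_slice pickleK_inv.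
by have := floor_itv (ln (c t)); rewrite intrD.
Qed.

(** The parameter of Young's inequality may depend on the spectral value.  On
    each logarithmic slice of [c] it is replaced by a constant; only the last
    integral pays for this, with the factor [expR 1]. *)
Lemma spectral_Young w c x y :
  measurable_fun setT w -> measurable_fun setT c ->
  (forall t, 0 <= w t) -> (forall t, 0 < c t) ->
  (\int[pvm_measure E x]_t (w t)%:E + \int[pvm_measure E y]_t (w t)%:E <=
   \int[pvm_measure E (x + y)%R]_t (w t)%:E +
   (\int[pvm_measure E x]_t (w t * c t)%:E +
    \int[pvm_measure E y]_t (expR 1 * (w t / c t))%:E))%E.
Proof.
move=> mw mc w0 c0.
have mS n := measurable_log_slice n mc.
have tS := @trivIset_log_slice c.
have US := bigcup_log_slice c.
have mwE : measurable_fun setT (fun t : measurableTypeR R => (w t)%:E).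
  exact/measurable_EFinP.
have mwc : measurable_fun setT (fun t : measurableTypeR R => (w t * c t)%:E).
  by apply/measurable_EFinP; exact: measurable_funM.
have mwc' : measurable_fun setT
    (fun t : measurableTypeR R => (expR 1 * (w t / c t))%:E).
  apply/measurable_EFinP; apply: measurable_funM => //.
  apply: measurable_funM => //.
  rewrite (_ : (fun t => _) = fun t => powR (c t) (-1)); last first.
    by apply/funext => t; rewrite powR_inv1// ltW.
  exact: (measurableT_comp (measurable_powR (-1)) mc).
have w0E t : (0 <= (w t)%:E)%E by rewrite lee_fin.
have wc0 t : (0 <= (w t * c t)%:E)%E by rewrite lee_fin mulr_ge0// ltW.
have wc'0 t : (0 <= (expR 1 * (w t / c t))%:E)%E.
  by rewrite lee_fin mulr_ge0 ?expR_ge0// divr_ge0// ltW.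
rewrite !(@integral_slices _ (log_slice c))//.
have i0 (z : H) (f : R -> \bar R) : (forall t, 0 <= f t)%E ->
    forall n : nat, (0 <= n)%N -> true ->
    (0 <= \int[pvm_measure E z]_(t in log_slice c n) f t)%E.
  by move=> f0 n _ _; apply: integral_ge0.
rewrite -!nneseriesD//; 
  try (by move=> n _ _; apply: adde_ge0; apply: i0); try by move=> *; apply: i0.
apply: lee_nneseries => [n _ _|n _]; first by rewrite adde_ge0// i0.
rewrite /log_slice; case kn : pickle_inv => [k|]; last by rewrite !integral_set0 !adde0.
have mk := mS n; rewrite /log_slice kn in mk.
apply: le_trans (spectral_Young_slice x y mk (expR_gt0 k%:~R) mw w0) _.
apply: leeD2l; apply: leeD.
- rewrite -ge0_integralZl ?lee_fin ?expR_ge0//; last exact: measurable_funTS.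
  apply: ge0_le_integral => //.
  + by move=> t _; rewrite -EFinM lee_fin mulr_ge0 ?expR_ge0.
  + by apply: measurable_funeM; exact: measurable_funTS.
  + exact: measurable_funTS.
  + move=> t /= /andP[kt _]; rewrite -EFinM lee_fin mulrC ler_wpM2l//.
    by rewrite -[leRHS]lnK ?posrE// ler_expR.
- rewrite -ge0_integralZl ?lee_fin ?invr_ge0 ?expR_ge0//; last exact: measurable_funTS.
  apply: ge0_le_integral => //.
  + by move=> t _; rewrite -EFinM lee_fin mulr_ge0 ?invr_ge0 ?expR_ge0.
  + by apply: measurable_funeM; exact: measurable_funTS.
  + exact: measurable_funTS.
  + move=> t /= /andP[_ kt]; rewrite -EFinM lee_fin mulrCA mulrC ler_wpM2l//.
    rewrite -expRN ler_pdivlMr// -[c t]lnK ?posrE// -expRD ler_expR.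
    by lra.
Qed.

Lemma pvm_domainB h x y : measurable_fun setT h ->
  pvm_domain E h x -> pvm_domain E h y -> pvm_domain E h (x - y).
Proof.
move=> mh hx hy; have [mh2 _] := integrableP _ _ _ hx.
have intE z : (\int[pvm_measure E z]_t `|(h t ^+ 2)%:E|%E =
    \int[pvm_measure E z]_t (h t ^+ 2)%:E)%E.
  by apply: eq_integral => t _; rewrite gee0_abs// lee_fin sqr_ge0.
have {}hx : (\int[pvm_measure E x]_t (h t ^+ 2)%:E < +oo)%E.
  by case/integrableP : hx; rewrite intE.
have {}hy : (\int[pvm_measure E y]_t (h t ^+ 2)%:E < +oo)%E.
  by case/integrableP : hy; rewrite intE.
apply/integrableP; split => //; rewrite intE.
have h0 (t : R) : (0 <= (h t ^+ 2)%:E)%E by rewrite lee_fin sqr_ge0.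
pose two := NngNum (ler0n R 2).
pose mu := measure_add (mscale two (pvm_measure E x)) (mscale two (pvm_measure E y)).
apply: (@le_lt_trans _ _ (\int[mu]_t (h t ^+ 2)%:E)%E).
  apply: ge0_le_measure_integral => // S mS.
  rewrite [leRHS](_ : _ =
      2%:E * pvm_measure E x S + 2%:E * pvm_measure E y S)%E; last first.
    exact: measure_addE.
  rewrite !pvm_measureE -!EFinM -!EFinD lee_fin pvmB//.
  exact: normB_sqr_le.
rewrite ge0_integral_measure_add// !ge0_integral_mscale//.
by rewrite lte_add_pinfty// lte_mul_pinfty//= lee_fin.
Qed.

End spectral_Young.

(** * Norms in the scale *)

Section scale.
Context {R : realType} {H : hilbertType R}.
Variable E : pvm H.
Implicit Types (x y : H) (nu : R).

Lemma measurable_powR_sqr nu :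
  measurable_fun setT (fun t : measurableTypeR R => ((t `^ nu) ^+ 2)%:E).
Proof.
by apply/measurable_EFinP; apply: measurable_funX; exact: (measurable_powR _).
Qed.

Lemma scale_norm_integral nu x : scale_space E nu x ->
  ((scale_norm E nu x ^+ 2)%:E = \int[pvm_measure E x]_t ((t `^ nu) ^+ 2)%:E)%E.
Proof.
move=> xnu; by apply: norm_pvm_integral => // t; exact: powR_ge0.
Qed.

Lemma scale_norm_integralZ (k : R) nu x : 0 <= k -> scale_space E nu x ->
  ((k * scale_norm E nu x ^+ 2)%:E =
   \int[pvm_measure E x]_t (k * (t `^ nu) ^+ 2)%:E)%E.
Proof.
move=> k0 xnu; rewrite EFinM scale_norm_integral// -ge0_integralZl//.
- exact: measurable_powR_sqr.
- by move=> t _; rewrite lee_fin sqr_ge0.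
Qed.

Lemma measurable_powR_sqrZ (k : R) nu :
  measurable_fun setT (fun t : measurableTypeR R => (k * (t `^ nu) ^+ 2)%:E).
Proof.
apply/measurable_EFinP; apply: measurable_funM => //.
by apply: measurable_funX; exact: (measurable_powR _).
Qed.

Lemma scale_spaceB nu x y :
  scale_space E nu x -> scale_space E nu y -> scale_space E nu (x - y).
Proof. exact: (pvm_domainB (measurable_powR nu)). Qed.

Lemma scale_space_le s u x : 0 <= s <= u -> scale_space E u x -> scale_space E s x.
Proof.
move=> /andP[s0 su] xu.
have i1 : (pvm_measure E x).-integrable setT (EFin \o cst 1).
  exact: (sfun_integrable E x (cst_sfun 1)).
have i1u : (pvm_measure E x).-integrable setT
    (EFin \o (fun t => 1 + (t `^ u) ^+ 2)) := integrableD measurableT i1 xu.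
apply: (le_integrable measurableT _ _ i1u); first exact: measurable_powR_sqr.
move=> t _; rewrite /= lee_fin ger0_norm ?sqr_ge0// ger0_norm; last first.
  by rewrite addr_ge0 ?sqr_ge0.
rewrite /powR; case: ifPn => [_|t0].
  case: (s == 0); last by rewrite expr0n/= addr_ge0 ?sqr_ge0.
  by rewrite expr1n lerDl sqr_ge0.
rewrite -!expRM_natl; case: (lerP 0 (ln t)) => lt0.
  rewrite (@le_trans _ _ (expR (2%:R * (u * ln t))))//; last by rewrite lerDr.
  by rewrite ler_expR ler_wpM2l// ler_wpM2r.
rewrite (@le_trans _ _ 1)//; last by rewrite lerDl expR_ge0.
rewrite -expR0 ler_expR pmulr_rle0// mulr_ge0_le0// ltW//.
Qed.

(** On the range of [E {0}] the generator vanishes, by the isometry, and it is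
    bounded from below.  Without this the value of the power function at [0] would
    spoil the laws of exponents.  Negative spectral values cause no such
    problem, since [powR] is identically [1] there. *)
Lemma pvm_singleton0 (D : set H) (L : H -> H) x :
  scale_generator D L -> spectral_measure_of E D L -> E [set 0] x = 0.
Proof.
move=> [_ _ _ _ [m m0 mL]] [DE LE].
set y := E [set 0] x.
have m1 : measurable ([set 0] : set (measurableTypeR R)) by exact: measurable_set1.
have yN : pvm_measure E y (~` [set 0]) = 0%E.
  rewrite pvm_measureE /y -pvmI//; last exact: measurableC.
  by rewrite setICl -pvm_measureE measure0.
have id0 : (\int[pvm_measure E y]_t (t ^+ 2)%:E = 0)%E.
  rewrite (ge0_negligible_integral (measurableC m1) measurableT)//.
  - by rewrite setTD setCK; apply: integral0_eq => t ->; rewrite expr0n.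
  - by apply/measurable_EFinP; apply: measurable_funX.
  - by move=> t _; rewrite lee_fin sqr_ge0.
have yD : pvm_domain E id y.
  apply/integrableP; split.
    by apply/measurable_EFinP; apply: measurable_funX.
  rewrite (eq_integral (fun t : measurableTypeR R => ((t : R) ^+ 2)%:E)) ?id0// => t _.
  by rewrite gee0_abs// lee_fin sqr_ge0.
have Dy : D y by rewrite DE.
have := is_pvm_integral_norm (@measurable_id _ _ _) yD (LE _ Dy).
rewrite /Rintegral id0 /= => /eqP; rewrite sqrf_eq0 => /eqP Ly0.
have := mL _ Dy; rewrite Ly0 pmulr_rle0// normr_le0 => /eqP; exact.
Qed.

Hypothesis E0 : forall x, E [set 0] x = 0.

Lemma ae_of_neq0 x (P : R -> Prop) : (forall t, t != 0 -> P t) ->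
  {ae pvm_measure E x, forall t, P t}.
Proof.
move=> P0; exists [set 0]; split; first exact: measurable_set1.
  by rewrite pvm_measureE E0 normr0 expr0n.
by move=> t /= nPt; apply: contrapT => /eqP t0; apply: nPt; exact: P0.
Qed.

Lemma powR_sqr nu (t : R) : t != 0 -> (t `^ nu) ^+ 2 = expR (2 * nu * ln t).
Proof. by move=> t0; rewrite /powR (negbTE t0) -expRM_natl mulrA. Qed.

(** Here [lam] is the logarithm of the cut-off [Lambda].  The weight below is
    [c = 2e / (1 + r)] with [r = (t / Lambda)^(-2(s+a))].  This choice makes
    [e * t^(2s) / c] exactly [t^(2s) / 2 + Lambda^(2(s+a)) t^(-2a) / 2], while
    [t^(2s) * c <= 2e * Lambda^(-2(u-s)) t^(2u)] holds because
    [u - s <= s + a]. *)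
Lemma scale_Young a s u lam x y : s <= u -> u <= 2 * s + a ->
  scale_space E s x -> scale_space E u x -> scale_space E s y ->
  scale_space E (- a) y -> scale_space E s (x + y) ->
  scale_norm E s x ^+ 2 + 2^-1 * scale_norm E s y ^+ 2 <=
  scale_norm E s (x + y) ^+ 2 +
  (2 * expR 1 * expR (- (2 * (u - s) * lam)) * scale_norm E u x ^+ 2 +
   2^-1 * expR (2 * (s + a) * lam) * scale_norm E (- a) y ^+ 2).
Proof.
move=> su usa xs xu ys ya xys.
pose r t := expR (- (2 * (s + a) * (ln t - lam))).
pose c t := 2 * expR 1 / (1 + r t).
pose w (t : R) := (t `^ s) ^+ 2.
have r1 t : 0 < 1 + r t by rewrite addr_gt0// expR_gt0.
have c0 t : 0 < c t by rewrite divr_gt0// mulr_gt0// expR_gt0.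
have w0 t : 0 <= w t by exact: sqr_ge0.
have mw : measurable_fun setT w.
  by apply: measurable_funX; exact: (measurable_powR _).
have mr : measurable_fun setT r.
  apply: measurableT_comp; first exact: measurable_expR.
  apply: measurable_funN; apply: measurable_funM => //.
  by apply: measurable_funB => //; exact: measurable_ln.
have m1r : measurable_fun setT (fun t => 1 + r t) by exact: measurable_funD.
have mc : measurable_fun setT c.
  apply: measurable_funM => //.
  rewrite (_ : (fun t => _) = fun t => powR (1 + r t) (-1)); last first.
    by apply/funext => t; rewrite powR_inv1// ltW.
  exact: (measurableT_comp (measurable_powR (-1)) m1r).
have := spectral_Young E x y mw mc w0 c0.
rewrite -!scale_norm_integral// -EFinD => Young.
have xbound : (\int[pvm_measure E x]_t (w t * c t)%:E <=
    (2 * expR 1 * expR (- (2 * (u - s) * lam)) * scale_norm E u x ^+ 2)%:E)%E.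
  rewrite scale_norm_integralZ ?mulr_ge0 ?expR_ge0//.
  apply: ae_ge0_le_integral => //.
  - by move=> t _; rewrite lee_fin mulr_ge0// ltW.
  - by apply/measurable_EFinP; exact: measurable_funM.
  - by move=> t _; rewrite lee_fin mulr_ge0 ?sqr_ge0// !mulr_ge0 ?expR_ge0.
  - exact: measurable_powR_sqrZ.
  apply: ae_of_neq0 => t t0 _; rewrite lee_fin /w /c !powR_sqr//.
  rewrite [leLHS](_ : _ = 2 * expR 1 * (expR (2 * s * ln t) / (1 + r t))); last first.
    by field; rewrite gt_eqF.
  rewrite -[leRHS]mulrA ler_wpM2l ?mulr_ge0 ?expR_ge0// -expRD.
  rewrite ler_pdivrMr// mulrDr mulr1 /r -expRD.
  (* Above the cut-off the summand 1 of 1 + r suffices, below it r does. *)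
  case: (lerP 0 (ln t - lam)) => tl.
    rewrite (@le_trans _ _ (expR (- (2 * (u - s) * lam) + 2 * u * ln t)))//.
      rewrite ler_expR -subr_ge0.
      rewrite [leRHS](_ : _ = 2 * ((u - s) * (ln t - lam))); last by ring.
      by rewrite mulr_ge0// mulr_ge0 ?subr_ge0// -subr_ge0.
    by rewrite lerDl expR_ge0.
  rewrite (@le_trans _ _ (expR (- (2 * (u - s) * lam) + 2 * u * ln t -
      2 * (s + a) * (ln t - lam))))//.
    rewrite ler_expR -subr_ge0.
    rewrite [leRHS](_ : _ = 2 * ((2 * s + a - u) * (lam - ln t))); last by ring.
    by rewrite mulr_ge0// mulr_ge0 ?subr_ge0// ltW// -subr_lt0.
  by rewrite lerDr expR_ge0.
have ybound : (\int[pvm_measure E y]_t (expR 1 * (w t / c t))%:E <=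
    (2^-1 * scale_norm E s y ^+ 2 +
     2^-1 * expR (2 * (s + a) * lam) * scale_norm E (- a) y ^+ 2)%:E)%E.
  set k := 2^-1 * expR _.
  have k0 : 0 <= k by rewrite mulr_ge0 ?expR_ge0.
  have kw0 nu t : 0 <= k * (t `^ nu) ^+ 2 by rewrite mulr_ge0 ?sqr_ge0.
  have half0 : 0 <= 2^-1 :> R by rewrite invr_ge0.
  rewrite EFinD [X in (_ <= X + _)%E](scale_norm_integralZ half0 ys).
  rewrite [X in (_ <= _ + X)%E](scale_norm_integralZ k0 ya).
  rewrite -ge0_integralD//; last 4 first.
  - by move=> t _; rewrite lee_fin mulr_ge0 ?sqr_ge0.
  - exact: measurable_powR_sqrZ.
  - by move=> t _; rewrite lee_fin.
  - exact: measurable_powR_sqrZ.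
  apply: ae_ge0_le_integral => //.
  - by move=> t _; rewrite lee_fin mulr_ge0 ?expR_ge0// divr_ge0// ltW.
  - apply/measurable_EFinP; apply: measurable_funM => //.
    rewrite (_ : (fun t => w t / c t) =
        fun t => w t * ((2 * expR 1)^-1 * (1 + r t))); last first.
      by apply/funext => t; rewrite /c invf_div; congr (_ * _); rewrite mulrC.
    by apply: measurable_funM => //; exact: measurable_funM.
  - by move=> t _; rewrite -EFinD lee_fin addr_ge0// mulr_ge0 ?sqr_ge0.
  - exact: (emeasurable_funD (measurable_powR_sqrZ 2^-1 s)
      (measurable_powR_sqrZ k (- a))).
  apply: ae_of_neq0 => t t0 _; rewrite -EFinD lee_fin.
  have -> : expR 1 * (w t / c t) = 2^-1 * (w t * (1 + r t)).
    rewrite /c; field.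
    by rewrite !gt_eqF ?expR_gt0.
  rewrite /w /k !powR_sqr//.
  rewrite [leRHS](_ : _ = 2^-1 * (expR (2 * s * ln t) +
      expR (2 * (s + a) * lam) * expR (2 * (- a) * ln t))); last by ring.
  rewrite ler_wpM2l// mulrDr mulr1 lerD2l.
  by rewrite /r -!expRD ler_expR le_eqVlt; apply/orP; left; apply/eqP; ring.
have half (p q z v v' : R) :
    p + q <= z + (v + (2^-1 * q + v')) -> p + 2^-1 * q <= z + (v + v') by lra.
apply: half; rewrite -lee_fin !EFinD in Young xbound ybound *.
exact: le_trans Young (leeD2l _ (leeD xbound ybound)).
Qed.

End scale.

(** * Concave functions and the choice of the parameter *)

Section concavity.
Context {R : realType}.
Implicit Types (phi f : R -> R).

Lemma concave_dilation phi mu t : concave_on_nonneg phi -> phi 0 = 0 ->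
  1 <= mu -> 0 <= t -> phi (mu * t) <= mu * phi t.
Proof.
move=> cphi phi0 mu1 t0; have mu0 : 0 < mu by exact: lt_le_trans mu1.
have i0 : 0 <= mu^-1 by rewrite invr_ge0 ltW.
have i1 : mu^-1 <= 1 by rewrite invf_le1.
have := cphi (Itv01 i0 i1) (mu * t) 0; rewrite !inE /= !in_itv/= !andbT.
rewrite mulr_ge0 ?(ltW mu0)// lexx => /(_ isT isT).
have dilE : conv (Itv01 i0 i1) (mu * t : convex_lmodType R^o) 0 = t :> R.
  transitivity (mu^-1 * (mu * t) + (1 - mu^-1) * 0); first by [].
  by rewrite mulr0 addr0 mulKf ?gt_eqF.
rewrite !convRE/= dilE.
rewrite phi0 oppr0 mulr0 addr0 mulrN lerN2.
by rewrite ler_pdivrMl.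
Qed.

Lemma psi_dilation phi u s a mu t : index_function phi -> concave_on_nonneg phi ->
  0 <= 2 * (u - s) / (a + u) -> 1 <= mu -> 0 <= t ->
  psi phi u s a (mu ^+ 2 * t) <= mu `^ (2 * (u - s) / (a + u)) * psi phi u s a t.
Proof.
move=> [phi_ge0 _ _ phi0] cphi q0 mu1 t0.
have mu0 : 0 <= mu by exact: le_trans mu1.
rewrite /psi sqrtrM ?sqr_ge0// sqrtr_sqr ger0_norm//.
rewrite -powRM// ?phi_ge0 ?sqrtr_ge0//; apply: ge0_ler_powR => //.
- by rewrite nnegrE phi_ge0// mulr_ge0 ?sqrtr_ge0.
- by rewrite nnegrE mulr_ge0// phi_ge0 ?sqrtr_ge0.
- by apply: concave_dilation => //; exact: sqrtr_ge0.
Qed.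

(** If [f] grows at most like [t^(q/2)] under dilation, with [q / 2 < 1], a tangent
    bound [f t <= f t0 + (t - t0) / al] also bounds every multiple [M * f t], with
    slope at most [1 / (4 * al)]: apply it at [t / mu^2] for a large [mu].  The
    constant [K] depends on [M] and [q] only, not on the point of tangency. *)
Lemma tangent_le_absorb f q M : 0 <= M -> q < 2 ->
  (forall mu t, 1 <= mu -> 0 <= t -> f (mu ^+ 2 * t) <= mu `^ q * f t) ->
  exists2 K, 0 <= K & forall t0 al, 0 < al -> 0 <= t0 ->
    (forall t, 0 <= t -> f t <= f t0 + (t - t0) / al) ->
    forall t, 0 <= t -> M * f t <= K * f t0 + t / (4 * al).
Proof.
move=> M0 q2 fdil; pose mu := (4 * M + 1) `^ (2 - q)^-1.
have M1 : 1 <= 4 * M + 1 by rewrite lerDr mulr_ge0.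
have M10 : 0 < 4 * M + 1 by exact: lt_le_trans M1.
have q20 : 0 < 2 - q by rewrite subr_gt0.
have mu1 : 1 <= mu.
  by rewrite -[leLHS](powRr0 (4 * M + 1)); apply: ler_powR => //; rewrite invr_ge0 ltW.
have mu0 : 0 < mu by exact: lt_le_trans mu1.
(* The choice of mu gives M * mu^(q - 2) = M / (4 M + 1) < 1/4. *)
have muq : mu `^ q * (4 * M + 1) = mu ^+ 2.
  have -> : 4 * M + 1 = mu `^ (2 - q).
    by rewrite -powRrM mulVf ?gt_eqF// powRr1// (le_trans _ M1).
  rewrite -powRD; last by apply/implyP => _; rewrite gt_eqF.
  by rewrite addrC subrK powR_mulrn// ltW.
exists (M * mu `^ q); first by rewrite mulr_ge0 ?powR_ge0.
move=> t0 al al0 t00 tan t tge0.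
have tmu : 0 <= t / mu ^+ 2 by rewrite divr_ge0// sqr_ge0.
have := fdil mu _ mu1 tmu; rewrite mulrC divfK ?sqrf_eq0 ?gt_eqF// => ft.
apply: (le_trans (ler_wpM2l M0 ft)); rewrite mulrA.
have Mmu : 0 <= M * mu `^ q by rewrite mulr_ge0 ?powR_ge0.
apply: (le_trans (ler_wpM2l Mmu (tan _ tmu))); rewrite mulrDr lerD2l.
apply: (@le_trans _ _ (M * mu `^ q * (t / mu ^+ 2 / al))).
  by rewrite ler_wpM2l// ler_wpM2r ?invr_ge0 ?(ltW al0)// lerBlDr lerDl.
rewrite -muq.
have -> : M * mu `^ q * (t / (mu `^ q * (4 * M + 1)) / al) =
    t / al * (M / (4 * M + 1)).
  by field; rewrite !gt_eqF ?powR_gt0.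
have -> : t / (4 * al) = t / al * 4^-1 by field; rewrite gt_eqF.
rewrite ler_wpM2l ?divr_ge0 ?(ltW al0)// ler_pdivrMr; last exact: lt_le_trans M1.
lra.
Qed.

End concavity.

(** * Source elements and Tikhonov minimisers *)

Section regularisation.
Context {R : realType} {X Y : hilbertType R}.
Variable E : pvm X.

Lemma escale_norm_le nu x b :
  (escale_norm E nu x <= b%:E)%E -> scale_space E nu x /\ scale_norm E nu x <= b.
Proof.
rewrite /escale_norm; case: ifPn => [|_]; last by rewrite leye_eq.
by rewrite inE lee_fin.
Qed.

Lemma escale_normE nu x : scale_space E nu x ->
  escale_norm E nu x = (scale_norm E nu x)%:E.
Proof. by rewrite /escale_norm => xnu; rewrite mem_set. Qed.

Lemma scale_norm0 nu : scale_space E nu 0 -> scale_norm E nu 0 = 0.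
Proof.
move=> E0nu; apply/eqP; rewrite -sqrf_eq0 -eqe scale_norm_integral//.
have mu0 : pvm_measure E 0 setT = 0%E.
  by rewrite pvm_measureE pvmT normr0 expr0n.
rewrite (ge0_negligible_integral measurableT measurableT _ _ mu0)//.
- by rewrite setDv integral_set0.
- exact: measurable_powR_sqr.
- by move=> t _; rewrite lee_fin sqr_ge0.
Qed.

Hypothesis E0 : forall x, E [set 0] x = 0.

(** [scale_Young] with the cut-off [b^(-1/(a+u))], which balances its two
    remainder terms. *)
Lemma scale_source a s u b x y :
  0 <= a -> s <= u -> 0 < u -> u <= 2 * s + a ->
  scale_space E s x -> scale_space E u x -> scale_space E s y ->
  scale_space E (- a) y -> scale_space E s (x + y) ->
  0 < b -> scale_norm E (- a) y <= b ->
  scale_norm E s x ^+ 2 + 2^-1 * scale_norm E s y ^+ 2 <=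
  scale_norm E s (x + y) ^+ 2 +
  (2 * expR 1 * scale_norm E u x ^+ 2 + 2^-1) * b `^ (2 * (u - s) / (a + u)).
Proof.
move=> a0 su u0 usa xs xu ys ya xys b0 yb.
have au : 0 < a + u by rewrite ltr_wpDl.
have := @scale_Young _ _ E E0 a s u (- (ln b / (a + u))) x y su usa xs xu ys ya xys.
move=> /le_trans; apply; rewrite lerD2l [leRHS]mulrDl; apply: lerD.
- rewrite -[leLHS]mulrA -[leRHS]mulrA; apply: ler_wpM2l; first by rewrite mulr_ge0 ?expR_ge0.
  rewrite mulrC; apply: ler_wpM2l; first exact: sqr_ge0.
  rewrite /powR gt_eqF// ler_expR le_eqVlt; apply/orP; left; apply/eqP.
  by field; rewrite gt_eqF.
- rewrite -mulrA; apply: ler_wpM2l => //.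
  have -> : b `^ (2 * (u - s) / (a + u)) =
      expR (2 * (s + a) * - (ln b / (a + u))) * b ^+ 2.
    have -> : b ^+ 2 = expR (2 * ln b) by rewrite expRM_natl lnK ?posrE.
    rewrite -expRD /powR gt_eqF//.
    by congr expR; field; rewrite gt_eqF.
  apply: ler_wpM2l; first exact: expR_ge0.
  rewrite ler_sqr ?nnegrE//; [exact: normr_ge0|exact: ltW].
Qed.

Lemma tikhonov_minimizer_le (DF : set X) (F : X -> Y) s al gd f fdag :
  0 < al -> DF fdag -> scale_space E s fdag ->
  tikhonov_minimizer E DF F s al gd f ->
  scale_space E s f /\
  2^-1 * `|F f - gd| ^+ 2 + al * scale_norm E s f ^+ 2 <=
  2^-1 * `|F fdag - gd| ^+ 2 + al * scale_norm E s fdag ^+ 2.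
Proof.
move=> al0 Dfdag fs [_ /(_ _ Dfdag)].
rewrite /tikhonov (escale_normE fs) -EFin_expe -EFinM -EFinD /escale_norm.
case: ifPn => [|_]; first by rewrite inE -EFin_expe -EFinM -EFinD lee_fin.
by rewrite expe2 mulyy gt0_muley ?lte_fin// addey// leye_eq.
Qed.

End regularisation.

(** * The convergence rate *)

(** The final bookkeeping on real numbers: [N], [S], [T], [D] are the squared
    norms [|f - fdag|_s^2], [`|F f - gd|^2], [`|F f - F fdag|^2], [`|F fdag - gd|^2],
    [W] is the stability term and [p = psi (d2)]. *)
Lemma error_arithmetic (R : realFieldType) (N S T D d2 al nf nd W K p : R) :
  0 < al -> D <= d2 -> T <= 2 * S + 2 * D ->
  2^-1 * S + al * nf <= 2^-1 * D + al * nd ->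
  nd + 2^-1 * N <= nf + W -> W <= K * p + T / (4 * al) -> d2 / al <= p ->
  N <= (2 * K + 2) * p.
Proof.
move=> al0 Dd TSD min cross absorb dp.
have i0 : 0 <= al^-1 by rewrite invr_ge0 ltW.
have := ler_wpM2l i0 min; have := ler_wpM2l i0 TSD; have := ler_wpM2l i0 Dd.
rewrite !mulrDr ![al^-1 * (al * _)]mulKf ?gt_eqF//.
move: absorb dp; have -> : T / (4 * al) = 4^-1 * (al^-1 * T) by field; rewrite gt_eqF.
rewrite [d2 / al]mulrC ![al^-1 * (_ * _)]mulrCA.
have -> : (2 * K + 2) * p = 2 * (K * p) + 2 * p by ring.
move: (al^-1 * T) (al^-1 * S) (al^-1 * D) (al^-1 * d2) (K * p) => t r e d q.
lra.
Qed.

Section convergence_rate.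
Context {R : realType} {X Y : hilbertType R}.
Variables (E : pvm X) (DF : set X) (F : X -> Y) (g : Y) (fdag : X) (a s u : R).
Hypothesis E0 : forall x, E [set 0] x = 0.
Hypothesis hF : basic_assumption E DF F g fdag a s u.

(** Conditional stability and [fdag] in the space of index [u] give a variational
    source condition.  If [F f = F fdag] the bound [b] of [scale_source] is not
    positive, and uniqueness of the solution is used instead. *)
Lemma variational_source_condition phi theta rho C Q :
  conditional_stability E DF F fdag a phi theta rho C Q ->
  exists2 M, 0 <= M & forall f, Q f -> scale_space E s f ->
    scale_norm E s fdag ^+ 2 + 2^-1 * scale_norm E s (f - fdag) ^+ 2 <=
    scale_norm E s f ^+ 2 + M * psi phi u s a (`|F f - F fdag| ^+ 2).
Proof.
move: hF => [_ _ [u0 udag [Ddag Fdag uniq]] [a0 s0 su usa _]].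
move=> [[[phi_ge0 _ phi_incr phi0] _] [_ _ C0] Qball Qstab].
have sdag : scale_space E s fdag.
  by apply: scale_space_le udag; rewrite s0 ltW.
exists ((2 * expR 1 * scale_norm E u fdag ^+ 2 + 2^-1) *
    C `^ (2 * (u - s) / (a + u))).
  by rewrite mulr_ge0 ?powR_ge0// addr_ge0// mulr_ge0 ?sqr_ge0// mulr_ge0 ?expR_ge0.
move=> f Qf sf; have [_ Df] := Qball _ Qf.
have [ya yb] := escale_norm_le (Qstab _ Qf).
have sB := scale_spaceB sf sdag.
have eqf : fdag + (f - fdag) = f by rewrite addrC subrK.
have [Ff|Ff] := eqVneq (F f) (F fdag).
  have fE : f = fdag by apply: uniq => //; rewrite Ff.
  have s00 : scale_space E s 0 by rewrite -(subrr fdag) -[X in X - _]fE.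
  rewrite fE subrr (scale_norm0 s00) expr0n mulr0 addr0 lerDl.
  by rewrite !mulr_ge0 ?powR_ge0// addr_ge0// mulr_ge0 ?sqr_ge0// mulr_ge0 ?expR_ge0.
have b0 : 0 < C * phi `|F f - F fdag|.
  rewrite mulr_gt0// -phi0 phi_incr// ?in_itv/= ?lexx ?normr_ge0//.
  by rewrite normr_gt0 subr_eq0.
have seqf : scale_space E s (fdag + (f - fdag)) by rewrite eqf.
have := scale_source E0 a0 (ltW su) u0 usa sdag udag sB ya seqf b0 yb.
rewrite eqf powRM ?(ltW C0)// ?phi_ge0// mulrA.
by rewrite /psi sqrtr_sqr normr_id.
Qed.

Lemma discrepancy_le (Ff Fd gd : Y) :
  `|Ff - Fd| ^+ 2 <= 2 * `|Ff - gd| ^+ 2 + 2 * `|Fd - gd| ^+ 2.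
Proof.
have -> : Ff - Fd = (Ff - gd) - (Fd - gd) by rewrite opprB addrA subrK.
exact: normB_sqr_le.
Qed.

(** The constant does not depend on the noise level, which gives the rate. *)
Lemma regularisation_error phi theta rho C Q :
  conditional_stability E DF F fdag a phi theta rho C Q ->
  exists2 K, 0 <= K & forall d al gd f, 0 < d -> 0 < al -> `|gd - g| <= d ->
    subdifferential (extend_pinfty (fun t => - psi phi u s a t)) (d ^+ 2)
      (- al^-1) ->
    tikhonov_minimizer E DF F s al gd f -> Q f ->
    scale_space E s (f - fdag) /\
    scale_norm E s (f - fdag) ^+ 2 <= K * psi phi u s a (d ^+ 2).
Proof.
move=> hstab; have [M M0 rate] := variational_source_condition hstab.
move: hF => [_ _ [u0 udag [Ddag Fdag _]] [a0 s0 su _ as_]].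
have sdag : scale_space E s fdag.
  by apply: scale_space_le udag; rewrite s0 ltW.
case: hstab => [[iphi cphi] _ _ _].
have au : 0 < a + u by rewrite ltr_wpDl.
have q0 : 0 <= 2 * (u - s) / (a + u).
  by rewrite divr_ge0 ?(ltW au)// mulr_ge0// subr_ge0 ltW.
have q2 : 2 * (u - s) / (a + u) < 2 by rewrite ltr_pdivrMr//; lra.
have dil mu t : 1 <= mu -> 0 <= t -> psi phi u s a (mu ^+ 2 * t) <=
    mu `^ (2 * (u - s) / (a + u)) * psi phi u s a t.
  by move=> mu1 t0; exact: psi_dilation.
have [K K0 absorb] := tangent_le_absorb M0 q2 dil.
exists (2 * K + 2); first by rewrite addr_ge0// mulr_ge0.
move=> d al gd f d0 al0 gdg sub min Qf.
have [sf le_min] := tikhonov_minimizer_le al0 Ddag sdag min.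
split; first exact: scale_spaceB.
have tan t : 0 <= t ->
    psi phi u s a t <= psi phi u s a (d ^+ 2) + (t - d ^+ 2) / al.
  move=> t0; have := sub t; rewrite /extend_pinfty sqr_ge0 t0 -EFinD lee_fin.
  by rewrite mulNr [al^-1 * _]mulrC; lra.
have dpsi : d ^+ 2 / al <= psi phi u s a (d ^+ 2).
  have := tan 0 (lexx _); rewrite sub0r mulNr.
  by have := powR_ge0 (phi (Num.sqrt 0)) (2 * (u - s) / (a + u)); rewrite -/(psi phi u s a 0); lra.
have noise : `|F fdag - gd| ^+ 2 <= d ^+ 2.
  by rewrite Fdag distrC ler_sqr ?nnegrE// ltW.
have data := discrepancy_le (F f) (F fdag) gd.
exact: (error_arithmetic al0 noise data le_min (rate _ Qf sf)
  (absorb _ _ al0 (sqr_ge0 d) tan _ (sqr_ge0 _)) dpsi).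
Qed.

End convergence_rate.

Unset Implicit Arguments.

Theorem corollary1 (R : realType) (X Y : hilbertType R)
  (hX : infinite_dimensional X /\ separable X)
  (hY : infinite_dimensional Y /\ separable Y)
  (DL : set X) (L : X -> X) (hL : scale_generator DL L)
  (E : pvm X) (hE : spectral_measure_of E DL L)
  (DF : set X) (F : X -> Y) (g : Y) (fdag : X) (a s u : R)
  (hF : basic_assumption E DF F g fdag a s u)
  (hill : locally_ill_posed DF F fdag)
  (phi : R -> R) (theta rho C : R) (Q : set X)
  (hstab : conditional_stability E DF F fdag a phi theta rho C Q)
  (gd : R -> Y) (hgd : forall d, 0 < d -> `|gd d - g| <= d)
  (f : R -> R -> X)
  (hf : forall d alpha, 0 < d -> 0 < alpha ->
    tikhonov_minimizer E DF F s alpha (gd d) (f d alpha))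
  (hpsi : concave_on_nonneg (psi phi u s a))
  (alpha : R -> R)
  (halpha : forall d, 0 < d -> 0 < alpha d /\
    subdifferential (extend_pinfty (fun t => - psi phi u s a t)) (d ^+ 2)
      (- (alpha d)^-1))
  (hQ : \forall d \near 0^'+, Q (f d (alpha d))) :
  [/\ (\forall d \near 0^'+, scale_space E s (f d (alpha d) - fdag)),
      (fun d => scale_norm E s (f d (alpha d) - fdag) : R^o)
        =O_ (0^'+) (fun d => Num.sqrt (psi phi u s a (d ^+ 2)) : R^o)
    & (fun d => Num.sqrt (psi phi u s a (d ^+ 2)) : R^o)
        =O_ (0^'+) (fun d => phi d `^ ((u - s) / (a + u)) : R^o)].
Proof.
have E0 x : E [set 0] x = 0 := pvm_singleton0 x hL hE.
have [K K0 rate] := regularisation_error E0 hF hstab.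
have near_rate : \forall d \near 0^'+,
    scale_space E s (f d (alpha d) - fdag) /\
    scale_norm E s (f d (alpha d) - fdag) ^+ 2 <= K * psi phi u s a (d ^+ 2).
  near=> d; have d0 : 0 < d by near: d; exact: nbhs_right_gt.
  have [al0 sub] := halpha d d0.
  apply: (rate d (alpha d) (gd d)) => //; [exact: hgd|exact: hf|].
  by near: d.
split.
- by apply: filterS near_rate => d [].
- apply/eqO_exP; exists (Num.sqrt K + 1); first by rewrite ltr_wpDl ?sqrtr_ge0.
  apply: filterS near_rate => d [_ rate_d].
  rewrite [leLHS]ger0_norm; last exact: normr_ge0.
  rewrite [X in _ <= _ * X]ger0_norm; last exact: sqrtr_ge0.
  rewrite mulrDl mul1r -sqrtrM// -[leLHS]addr0 lerD ?sqrtr_ge0//.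
  rewrite -[leLHS]ger0_norm; last exact: normr_ge0.
  by rewrite -sqrtr_sqr ler_sqrt// mulr_ge0// powR_ge0.
- apply/eqO_exP; exists 1 => //; near=> d.
  have d0 : 0 < d by near: d; exact: nbhs_right_gt.
  rewrite mul1r /psi sqrtr_sqr (ger0_norm (ltW d0)).
  rewrite -powR12_sqrt ?powR_ge0// -powRrM.
  rewrite [X in powR _ X](_ : _ = (u - s) / (a + u))//.
  by rewrite mulrAC [2 * _]mulrC mulfK ?pnatr_eq0.
Unshelve. all: by end_near.
Qed.
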